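(* For every $\sigma>0$ there is a constant $c(\sigma)>0$, depending only on $\sigma$, such that the following holds. For any positive $l_1,l_2,\delta$ with $10\delta<l_1<\frac1{10}$ and $10\delta<l_2<\frac1{10}$, one can find a planar convex body $D$ and a point $\boldsymbol{x}\in D$ (with $D$ and $\boldsymbol{x}$ depending only on $l_1,l_2,\delta$, not on $n$ or $\sigma$) satisfying $B^2\subset D\subset 4B^2$ and, with $\boldsymbol{u}:=\boldsymbol{x}/|\boldsymbol{x}|$ and $\boldsymbol{v}$ one of the two unit vectors orthogonal to $\boldsymbol{u}$, $$\delta=\max\{t:\boldsymbol{x}+t\boldsymbol{u}\in D\},\qquad l_i=\max\{t:\boldsymbol{x}+(-1)^it\boldsymbol{v}\in D\},\quad i=1,2,$$ and such that for any $\sigma>0$ and any positive integer $n$ with $\delta>\sigma n^{-2}$, $$\lambda_n(D,\boldsymbol{x})\ge c(\sigma)\, n^{-2}\sqrt{\min\{l_1l_2,\delta\}}.$$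
   Context: A convex body is a convex compact set with non-empty interior; $|\cdot|$ is the Euclidean norm and $B^2=\{\boldsymbol{y}\in\mathbb{R}^2:|\boldsymbol{y}|\le1\}$. Let $\mathcal{P}_{n,d}$ be the space of all real algebraic polynomials of total degree $\le n$ in $d$ variables. For a compact set $D\subset\mathbb{R}^d$ with non-empty interior, the Christoffel function (with uniform weight) is $\lambda_n(D,\boldsymbol{x})=\left(\sum_{k=1}^N\varphi_k(\boldsymbol{x})^2\right)^{-1}$, $\boldsymbol{x}\in D$, where $\{\varphi_k\}_{k=1}^N$ is an orthonormal basis of $\mathcal{P}_{n,d}$ with respect to $\langle f,g\rangle=\int_D f(\boldsymbol{y})g(\boldsymbol{y})\,d\boldsymbol{y}$. Equivalently, $\lambda_n(D,\boldsymbol{x})=\min\{\int_D f^2(\boldsymbol{y})\,d\boldsymbol{y}: f\in\mathcal{P}_{n,d},\ |f(\boldsymbol{x})|=1\}$. *)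

(* Defs.v *)
From HB Require Import structures.
From mathcomp Require Import all_boot all_order all_algebra.
From mathcomp Require Import all_classical all_reals all_analysis.
(* The notations of mpoly clash with those of mathcomp-analysis. *)
From mathcomp Require Import(canonicals, coercions) mpoly.

Set Implicit Arguments.
Unset Strict Implicit.
Unset Printing Implicit Defensive.

Import Order.TTheory GRing.Theory Num.Theory.
Import numFieldNormedType.Exports.

Local Open Scope classical_set_scope.
Local Open Scope ring_scope.

(* The library norm on R * R is the sup norm, so the Euclidean structure is
   given explicitly; the product topology is the Euclidean one. *)
Definition dot (R : realType) (a b : R * R) : R := a.1 * b.1 + a.2 * b.2.

Definition enorm (R : realType) (a : R * R) : R := Num.sqrt (dot a a).

Definition unit_disk (R : realType) : set (R * R) := [set y | enorm y <= 1].
Arguments unit_disk : clear implicits.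

Definition convex_body (R : realType) (D : set (R * R)) : Prop :=
  [/\ convex_set D, compact D & D° !=set0].

Definition is_max (R : realType) (A : set R) (m : R) : Prop :=
  A m /\ ubound A m.

Definition peval (R : realType) (p : mpoly.mpoly 2 R) (y : R * R) : R :=
  mpoly.meval (fun i : 'I_2 => if i == ord0 then y.1 else y.2) p.

(* mpoly.msize is the total degree plus one, and 0 for the zero polynomial. *)
Definition poly_le (R : realType) (n : nat) : set (mpoly.mpoly 2 R) :=
  [set p | (mpoly.msize p <= n.+1)%N].
Arguments poly_le : clear implicits.

Definition inner (R : realType) (D : set (R * R)) (f g : mpoly.mpoly 2 R) : R :=
  \int[(@lebesgue_measure R \x @lebesgue_measure R)%E]_(y in D)
    (peval f y * peval g y).

Definition orthonormal_basis (R : realType) (D : set (R * R)) (n N : nat)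
    (phi : 'I_N -> mpoly.mpoly 2 R) : Prop :=
  [/\ forall k, poly_le R n (phi k),
      forall j k, inner D (phi j) (phi k) = (j == k)%:R
    & forall f, poly_le R n f ->
        exists a : 'I_N -> R, f = \sum_(k < N) a k *: phi k].

Definition is_christoffel (R : realType) (n : nat) (D : set (R * R))
    (x : R * R) (l : R) : Prop :=
  exists (N : nat) (phi : 'I_N -> mpoly.mpoly 2 R),
    orthonormal_basis D n phi /\ l = (\sum_(k < N) peval (phi k) x ^+ 2)^-1.

(* The value in is_christoffel does not depend on the orthonormal basis; the
   default 0 is taken only when there is no orthonormal basis. *)
Definition christoffel (R : realType) (n : nat) (D : set (R * R))
    (x : R * R) : R :=
  xget 0 [set l | is_christoffel n D x l].

(* Main.v *)
(* Along the chord through x the body is bounded by the parabola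
   w = 2 + h(v), h(v) = delta (1 + v/l1) (1 - v/l2), continued by its tangents
   beyond v = - l1 and v = l2; here x = (0, 2) and h(0) = delta.

   The lower bound on the Christoffel function is f(x)^2 <= K \int_D f^2 for f
   of degree at most n, obtained from two univariate estimates. Translating the
   parabola down by delta gives a curve through x, on which f restricts to a
   polynomial of degree 2n in v; the interior estimate on [-A, A] with
   A = sqrt (min(l1 l2, delta) / delta), for which the parabola varies by a
   bounded amount, costs a factor n / A. Then on each vertical segment of
   length 2 hanging from the parabola the point at depth delta costs a factor
   n / sqrt delta, and A sqrt delta = sqrt (min(l1 l2, delta)).

   Both univariate estimates come from one trick: q(cos t) sin(N t) is a sine
   polynomial of degree n + N, so its square at one point is at most 2 (n + N)
   times the mean of its square, while sin(N t)^2 <= N sin t absorbs the weight of the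
   substitution w = cos t. The choice N = 1 serves an interior point, and N of
   order 1 / sqrt delta an endpoint at distance delta. *)
Require Import Defs.
From HB Require Import structures.
From mathcomp Require Import all_boot all_order all_algebra.
From mathcomp Require Import all_classical all_reals all_analysis.
From mathcomp Require Import measurable_realfun ring lra zify.
From mathcomp Require Import(canonicals, coercions) mpoly.

Import Order.TTheory GRing.Theory Num.Theory.
Import numFieldNormedType.Exports.
Local Open Scope classical_set_scope.
Local Open Scope ring_scope.

(** * Sine polynomials *)

Section SineInequality.
Context {R : realType}.
Implicit Types (g f : R -> R) (m n N : nat).
Local Notation mu := (@lebesgue_measure R).

Lemma continuous_integrable_itv f (a b : R) : continuous f ->
  mu.-integrable `[a, b] (EFin \o f).
Proof.
move=> cf; apply: continuous_compact_integrable; first exact: segment_compact.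
exact: continuous_subspaceT.
Qed.

Lemma Rintegral_derive f (F : R -> R) (a b : R) : a < b ->
  (forall x : R, is_derive x 1 F (f x)) -> continuous f ->
  \int[mu]_(x in `[a, b]) f x = F b - F a.
Proof.
move=> ab dF cf.
have cF : continuous F.
  by move=> x; apply/differentiable_continuous/derivable1_diffP; case: (dF x).
rewrite /Rintegral (@continuous_FTC2 _ f F)//.
- exact: continuous_subspaceT.
- split; first by move=> x _; case: (dF x).
  + exact/cvg_at_right_filter/cF.
  + exact/cvg_at_left_filter/cF.
- by move=> x _; rewrite derive1E; case: (dF x).
Qed.

Lemma continuous_cos_mul (c : R) : continuous (fun t => cos (c * t)).
Proof.
move=> t; apply: (@continuous_comp _ _ _ ( *%R c) cos); last exact: continuous_cos.
exact: mulrl_continuous.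
Qed.

Lemma continuous_sin_mul (c : R) : continuous (fun t => sin (c * t)).
Proof.
move=> t; apply: (@continuous_comp _ _ _ ( *%R c) sin); last exact: continuous_sin.
exact: mulrl_continuous.
Qed.

Lemma sin_natmul_pi n : sin (n%:R * pi) = 0 :> R.
Proof.
elim: n => [|n IH]; first by rewrite mul0r sin0.
by rewrite -natr1 mulrDl mul1r sinDpi IH oppr0.
Qed.

Lemma Rintegral_cos_nat n :
  \int[mu]_(t in `[0, pi]) cos (n%:R * t) = (n == 0%N)%:R * pi :> R.
Proof.
case: n => [|n].
  under eq_Rintegral do rewrite mul0r cos0.
  by rewrite Rintegral_cst//= lebesgue_measure_itv/= lte_fin pi_gt0/= subr0 mul1r.
have dF (x : R) : is_derive x 1 (fun t => n.+1%:R^-1 * sin (n.+1%:R * t)) (cos (n.+1%:R * x)).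
  apply: (@is_derive_eq _ _ _ (n.+1%:R^-1 \*: (sin \o (n.+1%:R \*: id)))).
  by rewrite /= [_ *: 1]mulr1 [cos _ * _]mulrC scalerA mulVf ?pnatr_eq0// scale1r.
rewrite (Rintegral_derive _ _ _ _ _ dF) ?pi_gt0//; last exact: continuous_cos_mul.
by rewrite sin_natmul_pi mulr0 mulr0 sin0 mulr0 subr0 mul0r.
Qed.

Lemma Rintegral_sin_sin j k :
  \int[mu]_(t in `[0, pi]) (sin (j.+1%:R * t) * sin (k.+1%:R * t)) =
  (j == k)%:R * (pi / 2) :> R.
Proof.
(* With [k <= j] the truncated difference [j - k] is the true difference of the frequencies, and it
   vanishes exactly when [j = k]. *)
wlog kj : j k / (k <= j)%N => [H|].
  case/orP: (leq_total k j) => [|/H]; first exact: H.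
  by rewrite eq_sym => <-; apply: eq_Rintegral => t _; rewrite mulrC.
have E t : sin (j.+1%:R * t) * sin (k.+1%:R * t) =
    2^-1 * (cos ((j - k)%N%:R * t) - cos ((j + k).+2%:R * t)) :> R.
  have -> : (j - k)%N%:R * t = j.+1%:R * t - k.+1%:R * t.
    by rewrite natrB// -!natr1; ring.
  have -> : (j + k).+2%:R * t = j.+1%:R * t + k.+1%:R * t.
    by rewrite -!natr1 natrD; ring.
  by rewrite cosB cosD; field.
under eq_Rintegral do rewrite E.
have ci (n : nat) : mu.-integrable `[0, pi] (EFin \o (fun t => cos (n%:R * t))).
  exact/continuous_integrable_itv/continuous_cos_mul.
rewrite RintegralZl//; last first.
  apply: continuous_integrable_itv => t.
  by apply: cvgB; exact: continuous_cos_mul.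
rewrite RintegralB//.
rewrite !Rintegral_cos_nat subn_eq0 [in RHS]eqn_leq kj andbT mul0r subr0.
by ring.
Qed.

Definition sine_poly m g :=
  exists a : 'I_m -> R, forall t, g t = \sum_(k < m) a k * sin (k.+1%:R * t).

Lemma sine_polyD m g f : sine_poly m g -> sine_poly m f ->
  sine_poly m (fun t => g t + f t).
Proof.
move=> [a ga] [b fb]; exists (fun k => a k + b k) => t.
by rewrite ga fb -big_split; apply: eq_bigr => k _; rewrite mulrDl.
Qed.

Lemma sine_poly_sin m k c : (k <= m)%N -> sine_poly m (fun t => c * sin (k%:R * t)).
Proof.
case: k => [_|k km].
  by exists (fun=> 0) => t; rewrite mul0r sin0 mulr0 big1// => k _; rewrite mul0r.
exists (fun i => (i == Ordinal km)%:R * c) => t.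
rewrite (bigD1 (Ordinal km))//= eqxx mul1r big1 ?addr0// => i /negbTE ->.
by rewrite !mul0r.
Qed.

Lemma sine_poly_sum m n (a : 'I_n -> R -> R) :
  (forall k, sine_poly m (a k)) -> sine_poly m (fun t => \sum_(k < n) a k t).
Proof.
elim: n a => [a _|n IH a ha].
  by exists (fun=> 0) => t; rewrite big_ord0 big1// => k _; rewrite mul0r.
under eq_fun do rewrite big_ord_recr /=.
by apply: sine_polyD; [exact: IH|exact: ha].
Qed.

(** The product formula writes [sin ((k+1) t) cos t] as the mean of [sin ((k+2) t)] and [sin (k t)].
    For [k = 0] the second sine vanishes, so the span of sines is preserved. *)
Lemma sine_poly_mul_cos m g : sine_poly m g -> sine_poly m.+1 (fun t => g t * cos t).
Proof.
move=> [a ga]; under eq_fun do rewrite ga big_distrl /=.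
apply: sine_poly_sum => k.
have E t : a k * sin (k.+1%:R * t) * cos t =
    a k / 2 * sin (k.+2%:R * t) + a k / 2 * sin (k%:R * t).
  have -> : k.+2%:R * t = k.+1%:R * t + t by rewrite -[in LHS]natr1; ring.
  have -> : k%:R * t = k.+1%:R * t - t by rewrite -[in RHS]natr1; ring.
  by rewrite sinD sinB; field.
under eq_fun do rewrite E.
by apply: sine_polyD; apply: sine_poly_sin; rewrite ?ltnS// (leq_trans (ltnW (ltn_ord k))).
Qed.

(** Induction along Horner's scheme: a constant contributes the frequency [N], and each factor ['X]
    is a multiplication by [cos t], which raises the largest frequency by one. *)
Lemma sine_poly_horner_cos (q : {poly R}) n N : (size q <= n.+1)%N ->
  sine_poly (n + N) (fun t => q.[cos t] * sin (N%:R * t)).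
Proof.
elim/poly_ind: q n => [n _|q c IH n].
  under eq_fun do rewrite horner0.
  by apply: sine_poly_sin; rewrite leq_addl.
rewrite size_MXaddC; have [->|q0] /= := eqVneq q 0.
  under eq_fun do rewrite mul0r add0r hornerC.
  by move=> _; apply: sine_poly_sin; rewrite leq_addl.
rewrite ltnS; case: n => [|n]; first by rewrite leqn0 size_poly_eq0 (negbTE q0).
move=> sq; have E t : (q * 'X + c%:P).[cos t] * sin (N%:R * t) =
    q.[cos t] * sin (N%:R * t) * cos t + c * sin (N%:R * t).
  by rewrite !hornerE; ring.
under eq_fun do rewrite E.
apply: sine_polyD; last by apply: sine_poly_sin; rewrite leq_addl.
by rewrite addSn; apply: sine_poly_mul_cos; exact: IH.
Qed.

Lemma continuous_sum n (h : 'I_n -> R -> R) :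
  (forall k, continuous (h k)) -> continuous (fun t => \sum_(k < n) h k t).
Proof.
move=> ch t; elim: n h ch => [|n IH] h ch.
  by under eq_fun do rewrite big_ord0; exact: cvg_cst.
under eq_fun do rewrite big_ord_recr /=; apply: cvgD; last exact: ch.
by apply: IH => k; exact: ch.
Qed.

Lemma Rintegral_sum_continuous n (h : 'I_n -> R -> R) (a b : R) :
  (forall k, continuous (h k)) ->
  \int[mu]_(t in `[a, b]) (\sum_(k < n) h k t) =
  \sum_(k < n) \int[mu]_(t in `[a, b]) h k t.
Proof.
elim: n h => [|n IH] h ch.
  under eq_Rintegral do rewrite big_ord0.
  by rewrite big_ord0 Rintegral_cst//= mul0r.
under eq_Rintegral do rewrite big_ord_recr /=.
rewrite big_ord_recr /= RintegralD//; [by rewrite IH| |exact: continuous_integrable_itv].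
apply: continuous_integrable_itv ; apply: continuous_sum => k; exact: ch.
Qed.

(** Parseval on [[0, pi]] turns the integral into [pi / 2] times the sum of the squared
    coefficients; Cauchy-Schwarz over the [m] terms then bounds the value at any point. *)
Lemma sine_poly_sq_le m g (t0 : R) : sine_poly m g ->
  g t0 ^+ 2 <= m%:R * (2 / pi) * \int[mu]_(t in `[0, pi]) g t ^+ 2.
Proof.
move=> [a ga].
have -> : \int[mu]_(t in `[0, pi]) g t ^+ 2 = (pi / 2) * \sum_(k < m) a k ^+ 2.
  have E t : g t ^+ 2 = \sum_(j < m) \sum_(k < m)
      a j * a k * (sin (j.+1%:R * t) * sin (k.+1%:R * t)).
    rewrite expr2 ga big_distrlr /=; apply: eq_bigr => j _.
    by apply: eq_bigr => k _; ring.
  under eq_Rintegral do rewrite E.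
  have cs j k : continuous (fun t : R => sin (j.+1%:R * t) * sin (k.+1%:R * t)).
    by move=> t; apply: cvgM; exact: continuous_sin_mul.
  rewrite Rintegral_sum_continuous => [|j]; last first.
    by apply: continuous_sum => k t; apply: cvgM; [exact: cvg_cst|exact: cs].
  rewrite big_distrr; apply: eq_bigr => j _ /=.
  rewrite Rintegral_sum_continuous => [|k t]; last first.
    by apply: cvgM; [exact: cvg_cst|exact: cs].
  rewrite (bigD1 j)//= big1 => [|k kj]; rewrite RintegralZl ?Rintegral_sin_sin//;
    do ?exact/continuous_integrable_itv/cs.
    by rewrite eqxx mul1r addr0; ring.
  by rewrite eq_sym (_ : (_ == _) = false) ?mul0r ?mulr0//; exact/negbTE.
have -> : m%:R * (2 / pi) * (pi / 2 * \sum_(k < m) a k ^+ 2) = m%:R * \sum_(k < m) a k ^+ 2.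
  have p0 : pi != 0 :> R by rewrite gt_eqF// pi_gt0.
  by move: pi p0 => x x0; field.
case: m a ga => [a ga|m a ga]; first by rewrite ga !big_ord0 expr0n mul0r.
(* Cauchy-Schwarz with |sin| <= 1, as the expansion of a sum of squares. *)
set A := \sum_(k < _) _; have m0 : 0 < m.+1%:R :> R by [].
have : 0 <= \sum_(k < m.+1) (m.+1%:R * a k - g t0 * sin (k.+1%:R * t0)) ^+ 2.
  by apply: sumr_ge0 => k _; exact: sqr_ge0.
have -> : \sum_(k < m.+1) (m.+1%:R * a k - g t0 * sin (k.+1%:R * t0)) ^+ 2 =
    m.+1%:R ^+ 2 * A - 2 * m.+1%:R * g t0 ^+ 2
    + g t0 ^+ 2 * \sum_(k < m.+1) sin (k.+1%:R * t0) ^+ 2.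
  rewrite (_ : 2 * m.+1%:R * g t0 ^+ 2 =
    2 * m.+1%:R * g t0 * \sum_(k < m.+1) a k * sin (k.+1%:R * t0)); last first.
    by rewrite -ga expr2 mulrA.
  rewrite /A !big_distrr -sumrB -big_split; apply: eq_bigr => k _ /=; ring.
have : \sum_(k < m.+1) sin (k.+1%:R * t0) ^+ 2 <= m.+1%:R.
  rewrite -[m.+1 in leRHS]card_ord -sumr_const; apply: ler_sum => k _.
  by rewrite -real_normK ?num_real// expr_le1// sin_max.
move=> /(ler_wpM2l (sqr_ge0 (g t0))) S1 S2.
rewrite -subr_ge0 -(pmulr_rge0 _ m0); move: S1 S2; set G := g t0; set S := _ * _; lra.
Qed.

(** By the addition formula each step from [N] to [N + 1] costs at most one more [sin t], the
    cosines being bounded by 1. *)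
Lemma norm_sin_nat_le N (t : R) : 0 <= t <= pi -> `|sin (N%:R * t)| <= N%:R * sin t.
Proof.
move=> t0; elim: N => [|N IH]; first by rewrite !mul0r sin0 normr0.
rewrite -natr1 !mulrDl !mul1r sinD (le_trans (ler_normD _ _))// lerD//.
  rewrite normrM (le_trans _ IH)// ler_piMr// cos_max//.
rewrite normrM (ger0_norm (sin_ge0_pi t0)) ler_piMl ?sin_ge0_pi// cos_max//.
Qed.

Lemma sin_nat_sq_le N (t : R) : 0 <= t <= pi -> sin (N%:R * t) ^+ 2 <= N%:R * sin t.
Proof.
move=> t0; rewrite -real_normK ?num_real// expr2.
rewrite (le_trans _ (norm_sin_nat_le N _ t0))// ler_piMr// sin_max//.
Qed.

(** With a polynomial primitive, the substitution [w = c + r cos t] reduces to the fundamental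
    theorem of calculus in each variable. The coefficient at index 0 is a division by zero, hence
    0. *)
Lemma poly_antiderivative (p : {poly R}) : exists P : {poly R}, P^`() = p.
Proof.
exists (\poly_(i < (size p).+1) (p`_i.-1 / i%:R)); apply/polyP => i.
rewrite coef_deriv coef_poly ltnS /=; case: ltnP => [|/(nth_default 0) ->]; last by rewrite mul0rn.
by move=> _; rewrite -(mulr_natr (_ / _)) divfK// pnatr_eq0.
Qed.

(** The affine map [q] moves the interval to [[-1, 1]], and [q(cos t) sin(N t)] is a sine polynomial
    with [n + N] frequencies. Bounding [sin(N t)^2] by [N sin t] leaves [N / r] times the Jacobian
    [r sin t] of [w = c + r cos t]. *)
Lemma horner_christoffel (p : {poly R}) n N (c r t0 : R) : (size p <= n.+1)%N -> 0 < r ->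
  p.[c + r * cos t0] ^+ 2 * sin (N%:R * t0) ^+ 2
  <= (n + N)%:R * N%:R * (2 / (pi * r)) * \int[mu]_(w in `[c - r, c + r]) p.[w] ^+ 2.
Proof.
move=> sp r0.
pose q := p \Po (r *: 'X + c%:P).
have qE y : q.[y] = p.[c + r * y] by rewrite horner_comp !hornerE addrC.
have sq : (size q <= n.+1)%N.
  rewrite (leq_trans (size_comp_poly_leq _ _))// ltnS -[n]muln1 leq_mul//.
    by case: size sp.
  suff : (size (r *: 'X + c%:P)%R <= 2)%N by case: size.
  rewrite (leq_trans (size_polyD _ _))//.
  rewrite geq_max (leq_trans (size_scale_leq _ _)) ?size_polyX//.
  by rewrite (leq_trans (size_polyC_leq1 _)).
have := @sine_poly_sq_le _ _ t0 (@sine_poly_horner_cos q n N sq).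
rewrite qE exprMn => /le_trans; apply.
rewrite -!mulrA ler_wpM2l//.
have [P PE] := poly_antiderivative (p ^+ 2).
have -> : \int[mu]_(w in `[c - r, c + r]) p.[w] ^+ 2 = P.[c + r] - P.[c - r].
  under eq_Rintegral do rewrite -horner_exp -PE.
  apply: Rintegral_derive; [lra|exact: continuous_horner].
have pi0 : pi != 0 :> R by rewrite gt_eqF// pi_gt0.
suff H : \int[mu]_(t in `[0, pi]) (q.[cos t] * sin (N%:R * t)) ^+ 2 <=
    N%:R / r * (P.[c + r] - P.[c - r]).
  rewrite [leLHS]mulrA (_ : N%:R * _ = 2 / pi * (N%:R / r * (P.[c + r] - P.[c - r]))).
    by rewrite ler_wpM2l// divr_ge0// pi_ge0.
  by move: pi pi0 => x x0; field; rewrite x0 gt_eqF.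
have cq : continuous (fun t : R => q.[cos t]).
  by move=> t; apply: (@continuous_comp _ _ _ cos (horner q));
    [exact: continuous_cos|exact: continuous_horner].
have cqs (N1 : R) : continuous (fun t : R => q.[cos t] ^+ 2 * (N1 * sin t)).
  move=> t; apply: cvgM; first by apply: cvgM; exact: cq.
  by apply: cvgM; [exact: cvg_cst|exact: continuous_sin].
apply: (@le_trans _ _ (\int[mu]_(t in `[0, pi]) (q.[cos t] ^+ 2 * (N%:R * sin t)))).
  apply: le_Rintegral => //.
  - apply: continuous_integrable_itv => t.
    by apply: cvgM; (apply: cvgM; [exact: cq|exact: continuous_sin_mul]).
  - exact/continuous_integrable_itv/cqs.
  - move=> t; rewrite /= in_itv/= => t0p; rewrite exprMn ler_wpM2l ?sqr_ge0//.
    exact: sin_nat_sq_le.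
(* The chain rule on [c + r cos t] produces [- r sin t]; the factor [- N / r] turns this into the
   weight [N sin t], so [Q.[cos t]] is a primitive of the integrand. *)
pose Q := - (N%:R / r) *: (P \Po (r *: 'X + c%:P)).
have QE y : Q.[y] = - (N%:R / r) * P.[c + r * y].
  by rewrite hornerZ horner_comp !hornerE addrC.
have dQ (t : R) : is_derive t 1 (fun t => Q.[cos t]) (q.[cos t] ^+ 2 * (N%:R * sin t)).
  apply: (@is_derive_eq _ _ _ (horner Q \o cos)).
  rewrite derivZ deriv_comp PE hornerZ hornerM horner_comp horner_exp qE
    derivD derivZ derivX derivC addr0 hornerZ hornerC.
  have -> : (r *: 'X + c%:P).[cos t] = c + r * cos t by rewrite !hornerE addrC.
  by field; rewrite gt_eqF.
rewrite (Rintegral_derive _ _ _ _ _ dQ) ?pi_gt0//.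
by rewrite cospi cos0 !QE mulrN1 mulr1; lra.
Qed.

End SineInequality.

(** * Univariate polynomials near an endpoint *)

Section EndpointChristoffel.
Context {R : realType}.
Local Notation mu := (@lebesgue_measure R).

Lemma sin_le_id (x : R) : 0 <= x -> sin x <= x.
Proof.
move=> x0; have [c _] := MVT_segment x0 (fun y _ => is_derive_sin y)
  (continuous_subspaceT (@continuous_sin R)).
rewrite sin0 !subr0 => ->.
by rewrite ler_piMl// cos_le1.
Qed.

(** Here [2 x] lies in [[pi / 2, pi]], so [cos (2 x) <= 0], and [sin x ^+ 2] is half of
    [1 - cos (2 x)]. *)
Lemma sin_sq_ge_half (x : R) : pi / 4 <= x <= pi / 2 -> 1 / 2 <= sin x ^+ 2.
Proof.
move=> /andP[x1 x2]; have : 0 <= sin (2 * x - pi / 2) by apply: sin_ge0_pi; lra.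
have -> : 2 * x - pi / 2 = x + x - pi / 2 by ring.
rewrite sinBpihalf cosD => H; have := cos2Dsin2 x; move: H; rewrite !expr2; lra.
Qed.

(** Take the least multiple of [t] that reaches [pi / 4]. If [t >= pi / 4] this is [t] itself;
    otherwise the previous multiple is below [pi / 4] and one more step stays below [pi / 2]. *)
Lemma exists_nat_sin (t : R) : 0 < t <= pi / 2 ->
  exists N : nat, N%:R * t <= pi / 2 /\ 1 / 2 <= sin (N%:R * t) ^+ 2.
Proof.
move=> /andP[t0 t2].
have [N0 N0P] : exists N : nat, pi / 4 <= N%:R * t.
  exists (Num.trunc (pi / 4 / t)).+1.
  by rewrite -ler_pdivrMr// ltW// truncnS_gt.
have exN : exists N : nat, pi / 4 <= N%:R * t by exists N0.
case: (ex_minnP exN) => N NP Nmin; exists N.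
suff N2 : N%:R * t <= pi / 2 by split=> //; apply: sin_sq_ge_half; rewrite NP.
case: N NP Nmin => [|N] NP Nmin; first by have := @pi_gt0 R; lra.
have [t4|t4] := leP (pi / 4) t.
  have := Nmin 1%N; rewrite mul1r => /(_ t4); case: N {Nmin NP} => // _.
  by rewrite mul1r.
have : N%:R * t < pi / 4.
  by rewrite ltNge; apply/negP => /Nmin; rewrite ltnn.
rewrite -[N.+1%:R]natr1 (mulrDl N%:R) mul1r; lra.
Qed.

(** The case [N = 1], [t0 = pi / 2] of the estimate above, with [2 / pi <= 1]. *)
Lemma horner_mid_le (p : {poly R}) n (A : R) : (size p <= n.+1)%N -> 0 < A ->
  p.[0] ^+ 2 <= (n.+1)%:R / A * \int[mu]_(w in `[- A, A]) p.[w] ^+ 2.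
Proof.
move=> sp A0; have := @horner_christoffel R p n 1 0 A (pi / 2) sp A0.
rewrite cos_pihalf mulr0 mul1r sin_pihalf expr1n !mulr1 !add0r addn1.
move=> /le_trans; apply; apply: ler_wpM2r; first by apply: Rintegral_ge0 => w _; exact: sqr_ge0.
apply: ler_wpM2l => //.
by rewrite invfM mulrA ler_piMl ?invr_ge0 ?(ltW A0)// ler_pdivrMr ?pi_gt0// mul1r pi_ge2.
Qed.

(** For [cos t0 = 1 - d] one has [t0 >= sin t0 = sqrt (2 d - d^2) >= sqrt d]. An [N] with
    [N t0 <= pi / 2] is thus at most [2 / sqrt d], while [sin(N t0)^2 >= 1 / 2] costs only a factor
    2. *)
Lemma horner_endpoint_le (p : {poly R}) n (c d : R) : (size p <= n.+1)%N -> 0 < d -> d <= 1 ->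
  p.[c + 1 - d] ^+ 2 <= 4 * (n%:R + 2 / Num.sqrt d) / Num.sqrt d *
    \int[mu]_(w in `[c - 1, c + 1]) p.[w] ^+ 2.
Proof.
move=> sp d0 d1.
have d11 : -1 <= 1 - d <= 1 by lra.
pose t0 := acos (1 - d).
have ct0 : cos t0 = 1 - d by rewrite acosK// in_itv.
have st0 : Num.sqrt d <= sin t0.
  rewrite sin_acos// ler_sqrt; nra.
have t0gt : 0 < t0 by rewrite acos_gt0//; lra.
have t0le : t0 <= pi / 2.
  rewrite leNgt; apply/negP => tp.
  have := acos_lepi d11; rewrite -/t0 => tpi.
  have : 0 < sin (t0 - pi / 2) by apply: sin_gt0_pi; have := @pi_gt0 R; lra.
  by rewrite sinBpihalf ct0; lra.
have [|N [Nt sN]] := exists_nat_sin t0; first by rewrite t0gt.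
have sd0 : 0 < Num.sqrt d by rewrite sqrtr_gt0.
have NS : N%:R <= 2 / Num.sqrt d.
  rewrite ler_pdivlMr// (@le_trans _ _ (N%:R * t0))//.
    by rewrite ler_wpM2l// (le_trans st0)// sin_le_id// ltW.
  by rewrite (le_trans Nt)// ltW// pihalf_lt2.
have := @horner_christoffel R p n N c 1 t0 sp ltr01.
rewrite ct0 mul1r mulr1 addrA.
set I := \int[_]_(_ in _) _ => H.
have I0 : 0 <= I by apply: Rintegral_ge0 => w _; exact: sqr_ge0.
have H1 : p.[c + 1 - d] ^+ 2 <= 2 * ((n + N)%:R * N%:R * (2 / pi) * I).
  by have := sqr_ge0 (p.[c + 1 - d]); nra.
apply: (le_trans H1); rewrite !mulrA; apply: ler_wpM2r => //.
have n0 : 0 <= n%:R :> R by [].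
have N0 : 0 <= N%:R :> R by [].
apply: (@le_trans _ _ (2 * (n%:R + N%:R) * N%:R)).
  rewrite natrD -!mulrA ler_wpM2l// ler_wpM2l ?addr_ge0// ler_piMr//.
  by rewrite ler_pdivrMr ?pi_gt0// mul1r pi_ge2.
have -> : 4 * (n%:R + 2 / Num.sqrt d) / Num.sqrt d =
    2 * (n%:R + 2 / Num.sqrt d) * (2 / Num.sqrt d) by ring.
by apply: ler_pM => //; rewrite ?pmulr_rge0 ?addr_ge0 ?ler_wpM2l// lerD2l.
Qed.

End EndpointChristoffel.

(** * Bivariate polynomials *)

Section BivariatePolynomials.
Context {R : realType}.
Implicit Types (f g : mpoly.mpoly 2 R) (y : R * R) (n : nat).

Lemma pevalE f y : peval f y =
  \sum_(m <- mpoly.msupp f) mpoly.mcoeff m f * (y.1 ^+ m ord0 * y.2 ^+ m (lift ord0 ord0)).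
Proof.
rewrite /peval mpoly.mevalE; apply: eq_bigr => m _.
by rewrite big_ord_recl big_ord1.
Qed.

Lemma mdeg2E (m : mpoly.multinom 2) : mpoly.mdeg m = (m ord0 + m (lift ord0 ord0))%N.
Proof. by rewrite mpoly.mdegE big_ord_recl big_ord1. Qed.

Lemma msupp_mdeg_le f n (m : mpoly.multinom 2) : poly_le R n f -> m \in mpoly.msupp f ->
  (m ord0 + m (lift ord0 ord0) <= n)%N.
Proof.
by move=> fn /mpoly.msize_mdeg_lt mf; rewrite -mdeg2E -ltnS (leq_trans mf).
Qed.

Lemma pevalD f g y : peval (f + g) y = peval f y + peval g y.
Proof. exact: mpoly.mevalD. Qed.

Lemma pevalZ (a : R) f y : peval (a *: f) y = a * peval f y.
Proof. exact: mpoly.mevalZ. Qed.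

Lemma peval_sum (I : finType) (F : I -> mpoly.mpoly 2 R) y :
  peval (\sum_i F i) y = \sum_i peval (F i) y.
Proof. exact: raddf_sum. Qed.

Lemma size_exp_le (P : {poly R}) d k : (size P <= d.+1)%N -> (size (P ^+ k) <= (d * k).+1)%N.
Proof.
move=> sP; rewrite (leq_trans (size_poly_exp_leq _ _))// ltnS leq_mul2r.
by case: (size P) sP => [|s]; rewrite ?leq0n ?orbT// ltnS => ->; rewrite orbT.
Qed.

(** Restriction to a polynomial curve: [d = 1] serves straight lines and, in the first coordinate
    block, the slices of the body; [d = 2] serves the parabola. *)
Lemma peval_poly f n d (P Q : {poly R}) : poly_le R n f ->
  (size P <= d.+1)%N -> (size Q <= d.+1)%N ->
  exists2 r : {poly R}, (size r <= (d * n).+1)%N &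
    forall t : R, r.[t] = peval f (P.[t], Q.[t]).
Proof.
move=> fn sP sQ; exists (\sum_(m <- mpoly.msupp f)
  mpoly.mcoeff m f *: (P ^+ m ord0 * Q ^+ m (lift ord0 ord0))); last first.
  move=> t; rewrite pevalE horner_sum; apply: eq_bigr => m _.
  by rewrite hornerZ hornerM !horner_exp.
rewrite big_seq; apply: (big_ind (fun r : {poly R} => (size r <= (d * n).+1)%N)).
- by rewrite size_poly0.
- by move=> p q sp sq; rewrite (leq_trans (size_polyD _ _))// geq_max sp.
move=> m mf; have md := msupp_mdeg_le _ _ _ fn mf.
rewrite (leq_trans (size_scale_leq _ _))// (leq_trans (size_polyMleq _ _))//.
have := size_exp_le P d (m ord0) sP; have := size_exp_le Q d (m (lift ord0 ord0)) sQ.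
nia.
Qed.

Lemma poly_eq0_of_roots (r : {poly R}) : (forall t : R, 0 < t < 1 -> r.[t] = 0) -> r = 0.
Proof.
move=> r0; apply/eqP/negPn/negP => rN0.
(* The points 1/2, 1/3, ... give [size r] distinct roots in the unit interval, more than the degree
   allows. *)
pose s := [seq (k.+2%:R^-1 : R) | k <- iota 0 (size r)].
have : (size s < size r)%N.
  apply: max_poly_roots => //.
    apply/allP => x /mapP[k _ ->]; apply/eqP/r0.
    by rewrite invr_gt0 ltr0n/= invf_lt1// ltr1n.
  rewrite map_inj_uniq ?iota_uniq// => i j /invr_inj/eqP.
  by rewrite eqr_nat => /eqP[].
by rewrite size_map size_iota ltnn.
Qed.

(* Kronecker substitution: for degree at most n the exponents of f(t, t^(n+1))
   determine the monomials of f. *)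
Lemma peval_eq0 f n : poly_le R n f ->
  (forall t : R, 0 < t < 1 -> peval f (t, t ^+ n.+1) = 0) -> f = 0.
Proof.
move=> fn f0.
pose key (m : mpoly.multinom 2) := (m ord0 + n.+1 * m (lift ord0 ord0))%N.
have r0 : \sum_(m <- mpoly.msupp f) mpoly.mcoeff m f *: 'X^(key m) = 0 :> {poly R}.
  apply: poly_eq0_of_roots => t t01.
  rewrite -[RHS](f0 t t01) pevalE horner_sum; apply: eq_bigr => m _.
  by rewrite hornerZ hornerXn exprD exprM.
have key_inj : {in mpoly.msupp f &, injective key}.
  move=> m1 m2 /(msupp_mdeg_le _ _ _ fn) d1 /(msupp_mdeg_le _ _ _ fn) d2 k12.
  have [e0 e1] : m1 ord0 = m2 ord0 /\ m1 (lift ord0 ord0) = m2 (lift ord0 ord0).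
    move: k12 d1 d2; rewrite /key; move: (m1 _) (m1 _) (m2 _) (m2 _) => b1 a1 b2 a2 k12 d1 d2.
    have b12 : b1 = b2.
      by apply/eqP; rewrite eqn_leq; apply/andP; split; rewrite leqNgt; apply/negP => ?; nia.
    by move: k12; rewrite b12 => /addIn.
  apply/mpoly.mnmP => i; case: (unliftP ord0 i) => [j ->|->//].
  by rewrite (ord1 j).
apply/mpoly.mpolyP => m; rewrite mpoly.mcoeff0.
have [mf|/mpoly.memN_msupp_eq0//] := boolP (m \in mpoly.msupp f).
move/(congr1 (fun p : {poly R} => p`_(key m))): r0.
rewrite coef0 coef_sum (bigD1_seq m) ?mpoly.msupp_uniq//= big1_seq => [|m' /andP[m'm m'f]].
  by rewrite addr0 coefZ coefXn eqxx mulr1.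
rewrite coefZ coefXn; case: eqP => [/key_inj mm'|_]; last by rewrite mulr0.
by rewrite mm' ?eqxx in m'm.
Qed.

Lemma measurable_peval f :
  measurable_fun [set: measurableTypeR R * measurableTypeR R] (peval f).
Proof.
rewrite (_ : peval f = fun y => \sum_(m <- mpoly.msupp f)
  mpoly.mcoeff m f * (y.1 ^+ m ord0 * y.2 ^+ m (lift ord0 ord0))); last first.
  by apply/funext => y; rewrite pevalE.
apply: measurable_sum => m.
apply: measurable_funM; first exact: measurable_cst.
apply: measurable_funM; apply: measurable_funX; [exact: measurable_fst|exact: measurable_snd].
Qed.

Lemma peval_bounded f (B : R) : exists M : R, forall y : R * R, `|y.1| <= B -> `|y.2| <= B ->
  `|peval f y| <= M.
Proof.
exists (\sum_(m <- mpoly.msupp f) `|mpoly.mcoeff m f| * (B ^+ m ord0 * B ^+ m (lift ord0 ord0))).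
move=> y y1 y2; rewrite pevalE (le_trans (ler_norm_sum _ _ _))//.
apply: ler_sum => m _; rewrite normrM ler_wpM2l// normrM !normrX.
have B0 : 0 <= B by rewrite (le_trans _ y1).
by apply: ler_pM; rewrite ?exprn_ge0// lerXn2r ?nnegrE.
Qed.

End BivariatePolynomials.

(** * The inner product on a bounded measurable set *)

Section InnerProduct.
Context {R : realType}.
Implicit Types (f g : mpoly.mpoly 2 R) (y : R * R) (n : nat).
Local Notation mu := (@lebesgue_measure R).
Local Notation mu2 := (@lebesgue_measure R \x @lebesgue_measure R)%E.
Variables (D : set (R * R)) (B : R).
Hypothesis mD : measurable (D : set (measurableTypeR R * measurableTypeR R)).
Hypothesis DB : forall y, D y -> `|y.1| <= B /\ `|y.2| <= B.

Let mu2D : (mu2 D < +oo)%E.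
Proof.
have mB : measurable (`[- B, B] : set (measurableTypeR R)) by exact: measurable_itv.
apply: (@le_lt_trans _ _ (mu2 (`[- B, B] `*` `[- B, B]))).
  apply: le_measure; rewrite ?inE//; first exact: measurableX.
  by move=> y /DB[]; rewrite !ler_norml /= !in_itv.
have -> : mu2 (`[- B, B] `*` `[- B, B]) = (mu `[(- B)%R, B]%classic * mu `[(- B)%R, B]%classic)%E.
  exact: product_measure1E.
rewrite lebesgue_measure_itv/=.
by case: ifP => _; rewrite ?mul0e ?ltry// -EFinM ltry.
Qed.

Let mpeval f g :
  measurable_fun (D : set (measurableTypeR R * measurableTypeR R)) (fun y => peval f y * peval g y).
Proof.
by apply: measurable_funM; apply: measurable_funTS; exact: measurable_peval.
Qed.

Lemma integrable_peval f g : mu2.-integrable D (EFin \o (fun y => peval f y * peval g y)).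
Proof.
apply: measurable_bounded_integrable; [exact: mD|exact: mu2D|exact: mpeval|].
have [M HM] := peval_bounded f B; have [M' HM'] := peval_bounded g B.
exists (M * M'); split; first exact: num_real.
move=> x Mx y /DB[y1 y2] /=; rewrite (le_trans _ (ltW Mx))// normrM.
by apply: ler_pM => //; [exact: HM|exact: HM'].
Qed.

Lemma innerC f g : inner D f g = inner D g f.
Proof. by apply: eq_Rintegral => y _; rewrite mulrC. Qed.

Lemma innerDl f1 f2 g : inner D (f1 + f2) g = inner D f1 g + inner D f2 g.
Proof.
rewrite /inner -RintegralD//; try exact: integrable_peval.
by apply: eq_Rintegral => y _; rewrite pevalD mulrDl.
Qed.

Lemma innerZl (a : R) f g : inner D (a *: f) g = a * inner D f g.
Proof.
rewrite /inner -RintegralZl//; last exact: integrable_peval.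
by apply: eq_Rintegral => y _; rewrite pevalZ mulrA.
Qed.

Lemma inner_ge0 f : 0 <= inner D f f.
Proof. by apply: Rintegral_ge0 => y _; rewrite -expr2 sqr_ge0. Qed.

(** Tonelli: the slice estimate is integrated over [v], and the strip between [lo] and [hi] is
    enlarged to [D], which only increases the integral of a square. *)
Lemma Rintegral_strip_le (F : {poly R}) f (a b : R) (lo hi : R -> R) (K : R) : 0 <= K ->
  (forall v w, a <= v <= b -> lo v <= w <= hi v -> D (v, w)) ->
  (forall v, a <= v <= b ->
    F.[v] ^+ 2 <= K * \int[mu]_(w in `[lo v, hi v]) peval f (v, w) ^+ 2) ->
  \int[mu]_(v in `[a, b]) F.[v] ^+ 2 <= K * inner D f f.
Proof.
move=> K0 sub FK.
pose h : measurableTypeR R * measurableTypeR R -> \bar R :=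
  (EFin \o (fun y => peval f y * peval f y)) \_ D.
have mh : measurable_fun setT h.
  apply/(measurable_restrictT _ _).1 => //.
  exact/measurable_EFinP.
have h0 y : (0 <= h y)%E.
  by rewrite /h patchE; case: ifP => // _; rewrite lee_fin -expr2 sqr_ge0.
have innerE : ((inner D f f)%:E = \int[mu]_v \int[mu]_w h (v, w))%E.
  rewrite -fubini_tonelli1// -integral_mkcond fineK//.
  exact/integrable_fin_num/integrable_peval.
(* On each vertical line [f] is a univariate polynomial, hence continuous, so the slice integrals
   are finite. *)
have slice v : exists r : {poly R}, forall w, r.[w] = peval f (v, w).
  have [|||r _ rE] := @peval_poly R f (mpoly.msize f) 1 v%:P 'X.
  - exact: leqnSn.
  - by rewrite (leq_trans (size_polyC_leq1 _)).
  - by rewrite size_polyX.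
  by exists r => w; rewrite rE hornerC hornerX.
have mG : measurable_fun setT (fun v => \int[mu]_w h (v, w))%E.
  by have := measurable_fun_fubini_tonelli_F (m2 := mu) h mh h0.
have cF2 : continuous (fun v => F.[v] ^+ 2).
  by move=> v; apply: cvgM; exact: continuous_horner.
rewrite -lee_fin EFinM innerE -ge0_integralZl//; last first.
  by move=> v _; exact: integral_ge0.
rewrite /Rintegral fineK; last first.
  by apply/integrable_fin_num => //; exact: continuous_integrable_itv.
rewrite integral_mkcond; apply: ge0_le_integral => //.
- by move=> v _; rewrite patchE; case: ifP => // _; rewrite lee_fin sqr_ge0.
- apply/(measurable_restrictT _ _).1 => //.
  apply/measurable_EFinP/measurable_funTS; exact: continuous_measurable_fun.
- by apply: emeasurable_funM => //.
move=> v _; rewrite patchE; case: ifP => [|_]; last first.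
  by rewrite mule_ge0// integral_ge0.
rewrite inE /= in_itv/= => vab.
have [r rE] := slice v.
have cr2 : continuous (fun w => r.[w] ^+ 2).
  by move=> w; apply: cvgM; exact: continuous_horner.
apply: (@le_trans _ _ (K * \int[mu]_(w in `[lo v, hi v]) r.[w] ^+ 2)%:E).
  by rewrite lee_fin; under eq_Rintegral do rewrite rE; exact: FK.
rewrite EFinM lee_wpmul2l// /Rintegral fineK; last first.
  by apply/integrable_fin_num => //; exact: continuous_integrable_itv.
rewrite integral_mkcond; apply: ge0_le_integral => //.
- by move=> w _; rewrite patchE; case: ifP => // _; rewrite lee_fin sqr_ge0.
- apply/(measurable_restrictT _ _).1 => //.
  apply/measurable_EFinP/measurable_funTS; exact: continuous_measurable_fun.
- exact: measurableT_comp.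
move=> w _; rewrite patchE; case: ifP => // wv.
rewrite /h patchE mem_set; first by rewrite lee_fin rE expr2.
by apply: sub => //; move: wv; rewrite inE /= in_itv.
Qed.

End InnerProduct.

(** * Orthonormal bases and the Christoffel function *)

Section GramSchmidt.
Context {R : realType} {V : lmodType R}.
Variables (ip : V -> V -> R) (W : set V).
Hypothesis ipC : forall u v, ip u v = ip v u.
Hypothesis ipDl : forall u1 u2 v, ip (u1 + u2) v = ip u1 v + ip u2 v.
Hypothesis ipZl : forall a u v, ip (a *: u) v = a * ip u v.
Hypothesis ip_ge0 : forall u, 0 <= ip u u.
Hypothesis ip_eq0 : forall u, W u -> ip u u = 0 -> u = 0.
Hypothesis W0 : W 0.
Hypothesis WD : forall u v, W u -> W v -> W (u + v).
Hypothesis WZ : forall a u, W u -> W (a *: u).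

Lemma ip_suml (I : finType) (F : I -> V) v : ip (\sum_i F i) v = \sum_i ip (F i) v.
Proof.
apply: (big_morph (ip^~ v)) => //.
by rewrite -(scale0r 0) ipZl mul0r.
Qed.

(** Induction on the list: [v] minus its projection is either zero, and [v] adds nothing, or it is
    normalised and joined to the family. Dependent lists are thus allowed and [N] may be smaller
    than the length. *)
Lemma gram_schmidt (s : seq V) : (forall v, v \in s -> W v) ->
  exists (N : nat) (phi : 'I_N -> V),
    [/\ forall k, W (phi k), forall j k, ip (phi j) (phi k) = (j == k)%:R
      & forall v, v \in s -> exists a : 'I_N -> R, v = \sum_(k < N) a k *: phi k].
Proof.
elim: s => [_|v s IH sW].
  by exists 0%N, (fun=> 0); split => // -[].
have [u us|N [phi [phiW phiO phiS]]] := IH; first by apply: sW; rewrite inE us orbT.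
pose r := v - \sum_(k < N) ip v (phi k) *: phi k.
have vE : v = r + \sum_(k < N) ip v (phi k) *: phi k by rewrite subrK.
have Wv : W v by apply: sW; rewrite inE eqxx.
have Wr : W r.
  apply: WD => //; rewrite -scaleN1r; apply: WZ.
  by apply: (big_ind W) => // k _; exact: WZ.
have rphi j : ip r (phi j) = 0.
  rewrite ipDl -scaleN1r ipZl ip_suml (bigD1 j)//= big1 => [|k kj].
    by rewrite ipZl phiO eqxx mulr1 addr0 mulN1r subrr.
  by rewrite ipZl phiO (negbTE kj) mulr0.
have [r0|r0] := eqVneq r 0.
  exists N, phi; split => // u; rewrite inE => /predU1P[->|]; last exact: phiS.
  by exists (fun k => ip v (phi k)); rewrite {1}vE r0 add0r.
have ipr : 0 < ip r r.
  rewrite lt_neqAle ip_ge0 andbT eq_sym; apply: contra_neq r0; exact: ip_eq0.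
pose c := (Num.sqrt (ip r r))^-1.
have cr : c * (c * ip r r) = 1.
  by rewrite mulrA -expr2 exprVn sqr_sqrtr// mulVf// gt_eqF.
(* The new vector sits at [ord0] and the old family is shifted by [lift ord0]. *)
exists N.+1, (fun k => if unlift ord0 k is Some j then phi j else c *: r); split.
- by move=> k; case: unlift => // *; exact: WZ.
- move=> j k; case: (unliftP ord0 j) => [j' ->|->]; case: (unliftP ord0 k) => [k' ->|->].
  + by rewrite ?liftK ?phiO (inj_eq lift_inj).
  + by rewrite ?liftK ?unlift_none ipC ipZl rphi mulr0 eq_sym (negbTE (neq_lift _ _)).
  + by rewrite ?liftK ?unlift_none ipZl rphi mulr0 (negbTE (neq_lift _ _)).
  + by rewrite ?unlift_none ipZl ipC ipZl cr eqxx.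
move=> u; rewrite inE => /predU1P[->|/phiS[a ->]].
  exists (fun k => if unlift ord0 k is Some j then ip v (phi j) else c^-1).
  rewrite big_ord_recl unlift_none scalerA mulVf ?scale1r; last first.
    by rewrite invr_eq0 gt_eqF// sqrtr_gt0.
  by rewrite {1}vE; congr (_ + _); apply: eq_bigr => k _; rewrite liftK.
exists (fun k => if unlift ord0 k is Some j then a j else 0).
rewrite big_ord_recl unlift_none scale0r add0r.
by apply: eq_bigr => k _; rewrite liftK.
Qed.

End GramSchmidt.

Section Christoffel.
Context {R : realType}.
Implicit Types (f g : mpoly.mpoly 2 R) (y : R * R) (n : nat).
Local Notation mu := (@lebesgue_measure R).
Variables (D : set (R * R)) (B : R).
Hypothesis mD : measurable (D : set (measurableTypeR R * measurableTypeR R)).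
Hypothesis DB : forall y, D y -> `|y.1| <= B /\ `|y.2| <= B.

Lemma poly_leD n f g : poly_le R n f -> poly_le R n g -> poly_le R n (f + g).
Proof.
by move=> fn gn; rewrite /poly_le /= (leq_trans (mpoly.msizeD_le _ _))// geq_max fn.
Qed.

Lemma poly_leZ n (a : R) f : poly_le R n f -> poly_le R n (a *: f).
Proof. by move=> fn; rewrite /poly_le /= (leq_trans (mpoly.msizeZ_le _ _)). Qed.

Lemma poly_le0 n : poly_le R n 0.
Proof. by rewrite /poly_le /= mpoly.msize0. Qed.

(** Gram-Schmidt on the monomials; [bmultinom 2 n.+1] enumerates the exponents of degree strictly
    below [n.+1]. *)
Lemma orthonormal_basis_exists n :
  (forall f, poly_le R n f -> inner D f f = 0 -> f = 0) ->
  exists (N : nat) (phi : 'I_N -> mpoly.mpoly 2 R), orthonormal_basis D n phi.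
Proof.
move=> inner0.
pose s := [seq mpoly.mpolyX R (val m) | m : mpoly.bmultinom 2 n.+1].
have [N [phi [phiW phiO phiS]]] : exists (N : nat) (phi : 'I_N -> mpoly.mpoly 2 R),
    [/\ forall k, poly_le R n (phi k), forall j k, inner D (phi j) (phi k) = (j == k)%:R
      & forall v, v \in s -> exists a : 'I_N -> R, v = \sum_(k < N) a k *: phi k].
  apply: gram_schmidt.
  - exact: innerC.
  - exact: (innerDl D B mD DB).
  - exact: (innerZl D B mD DB).
  - exact: inner_ge0.
  - exact: inner0.
  - exact: poly_le0.
  - exact: poly_leD.
  - exact: poly_leZ.
  - move=> v /mapP[m _ ->]; rewrite /poly_le /= mpoly.msizeX; exact: mpoly.bmdeg.
exists N, phi; split => // f fn.
have span_sum : forall I (r : seq I) (F : I -> mpoly.mpoly 2 R),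
    (forall i, exists a : 'I_N -> R, F i = \sum_(k < N) a k *: phi k) ->
    exists a : 'I_N -> R, \sum_(i <- r) F i = \sum_(k < N) a k *: phi k.
  move=> I r F HF.
  apply: (big_ind (fun v => exists a : 'I_N -> R, v = \sum_(k < N) a k *: phi k)) => //.
    by exists (fun=> 0); rewrite big1// => k _; rewrite scale0r.
  move=> _ _ [a ->] [b ->]; exists (fun k => a k + b k).
  by rewrite -big_split; apply: eq_bigr => k _; rewrite scalerDl.
rewrite (mpoly.mpolywE fn); apply: span_sum => m.
have [|a ->] := phiS (mpoly.mpolyX R (val m)).
  by apply/mapP; exists m; rewrite ?mem_enum.
exists (fun k => mpoly.mcoeff (val m) f * a k).
by rewrite scaler_sumr; apply: eq_bigr => k _; rewrite scalerA.
Qed.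

(** The reproducing kernel at [x], here [f], satisfies [f(x) = <f, f> = S] with [S] the inverse of
    the Christoffel function. The bound applied to it reads [S^2 <= K S]. *)
Lemma christoffel_ge n (x : R * R) (K : R) : 0 < K ->
  (forall f, poly_le R n f -> inner D f f = 0 -> f = 0) ->
  (forall f, poly_le R n f -> peval f x ^+ 2 <= K * inner D f f) ->
  K^-1 <= christoffel n D x.
Proof.
move=> K0 inner0 HK.
have [N0 [phi0 b0]] := orthonormal_basis_exists n inner0.
(* Since an orthonormal basis exists, [xget] returns a genuine value and not its default 0. *)
have [N [phi [[phiW phiO phiS] ->]]] : is_christoffel n D x (christoffel n D x).
  by apply: xgetPex; eexists; exists N0, phi0; split; [exact: b0|reflexivity].
set S := \sum_(k < N) _.
pose f := \sum_(k < N) peval (phi k) x *: phi k.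
have fn : poly_le R n f.
  apply: (big_ind (poly_le R n)); [exact: poly_le0|exact: poly_leD|].
  by move=> k _; exact: poly_leZ.
have fx : peval f x = S.
  by rewrite peval_sum; apply: eq_bigr => k _; rewrite pevalZ expr2.
have ff : inner D f f = S.
  rewrite {1}/f (ip_suml _ (innerDl D B mD DB) (innerZl D B mD DB)); apply: eq_bigr => j _.
  rewrite (innerZl D B mD DB) innerC (ip_suml _ (innerDl D B mD DB) (innerZl D B mD DB)).
  rewrite (bigD1 j)//= big1 => [|k kj]; rewrite (innerZl D B mD DB) phiO.
    by rewrite eqxx mulr1 addr0 expr2.
  by rewrite (negbTE kj) mulr0.
(* If [S] vanished, every [phi k] would vanish at [x], and so would the constant 1, which lies in
   their span. *)
have S0 : 0 < S.
  rewrite lt_neqAle sumr_ge0 ?andbT; last by move=> k _; exact: sqr_ge0.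
  apply/eqP => /esym/eqP; rewrite psumr_eq0 => [/allP S0|k _]; last exact: sqr_ge0.
  have [|a aE] := phiS 1; first by rewrite /poly_le /= mpoly.msize1.
  have := oner_eq0 R; rewrite -[1](mpoly.meval1 (fun i : 'I_2 => if i == ord0 then x.1 else x.2)).
  rewrite -/(peval 1 x) aE peval_sum big1 ?eqxx// => k _.
  have := S0 k (mem_index_enum _); rewrite sqrf_eq0 => /eqP phk.
  by rewrite pevalZ phk mulr0.
have := HK _ fn; rewrite fx ff expr2 ler_pM2r// => SK.
by rewrite lef_pV2.
Qed.

(** A bound with some finite [K], used only to show that the inner product is definite. *)
Lemma horner_interior_le n (s : R) : -1 < s < 1 -> exists2 K : R, 0 <= K &
  forall p : {poly R}, (size p <= n.+1)%N ->
    p.[s] ^+ 2 <= K * \int[mu]_(w in `[-1, 1]) p.[w] ^+ 2.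
Proof.
move=> s1; pose t := acos s.
have ct : cos t = s by rewrite acosK// in_itv/= !ltW//; case/andP: s1.
have st : 0 < sin t by apply: sin_gt0_pi; rewrite acos_gt0 ?acos_ltpi//; lra.
exists ((n + 1)%:R * 1%:R * (2 / (pi * 1)) / sin t ^+ 2).
  rewrite divr_ge0 ?sqr_ge0// !mulr_ge0// ?invr_ge0 ?mulr_ge0// pi_ge0//.
move=> p sp; have := @horner_christoffel R p n 1 0 1 t sp ltr01.
rewrite ct mul1r add0r (mul1r t) sub0r add0r => H.
by rewrite mulrAC ler_pdivlMr// exprn_gt0.
Qed.

(** On the square contained in [D], the univariate bound is used in [w] and then in [v]. A zero norm
    makes [f] vanish at each [(t, t^(n+1))], and Kronecker substitution concludes. *)
Lemma inner_eq0 n f : (forall v w, -1 <= v <= 1 -> -1 <= w <= 1 -> D (v, w)) ->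
  poly_le R n f -> inner D f f = 0 -> f = 0.
Proof.
move=> sq fn f0; apply: (peval_eq0 f n fn) => t t01.
have [s1 s2] : -1 < t < 1 /\ -1 < t ^+ n.+1 < 1.
  split; first by lra.
  have : 0 < t ^+ n.+1 by rewrite exprn_gt0//; lra.
  have : t ^+ n.+1 < 1 by rewrite exprn_ilt1//; lra.
  lra.
have [K1 K10 HK1] := horner_interior_le n t s1.
have [K2 K20 HK2] := horner_interior_le n (t ^+ n.+1) s2.
have [||F sF FE] := @peval_poly R f n 1 'X (t ^+ n.+1)%:P fn.
- by rewrite size_polyX.
- by rewrite (leq_trans (size_polyC_leq1 _)).
have FK v : -1 <= v <= 1 ->
    F.[v] ^+ 2 <= K2 * \int[mu]_(w in `[-1, 1]) peval f (v, w) ^+ 2.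
  move=> _; have [||r sr rE] := @peval_poly R f n 1 v%:P 'X fn.
  - by rewrite (leq_trans (size_polyC_leq1 _)).
  - by rewrite size_polyX.
  rewrite mul1n in sr; have := HK2 r sr.
  rewrite rE FE !hornerE => /le_trans; apply; rewrite le_eqVlt; apply/orP; left.
  by apply/eqP; congr (_ * _); apply: eq_Rintegral => w _; rewrite rE !hornerE.
have := Rintegral_strip_le D B mD DB F f (-1) 1 (fun=> -1) (fun=> 1) K2 K20 sq FK.
rewrite f0 mulr0 => I0; rewrite mul1n in sF.
have := HK1 F sF; rewrite FE !hornerE => H.
apply/eqP; rewrite -sqrf_eq0 eq_le sqr_ge0 andbT (le_trans H)//.
by rewrite mulr_ge0_le0.
Qed.

End Christoffel.

(** * The body *)

Section ParabolicBody.
Context {R : realType}.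
Variables (l1 l2 d : R).

Let k := d / (l1 * l2).

(* [h v + k (v - t)^2], with [h v = k (v + l1) (l2 - v)], is affine in [v]: it is
   the tangent of the parabola at [t]. *)
Definition parabolic_body : set (R * R) :=
  [set y | [/\ `|y.1| <= 5 / 2, `|y.2| <= 5 / 2 & forall t, - l1 <= t <= l2 ->
    y.2 <= 2 + k * ((y.1 + l1) * (l2 - y.1) + (y.1 - t) ^+ 2)]].

Hypothesis pos : [/\ 0 < l1, 0 < l2 & 0 < d].
Hypothesis small : [/\ 10 * d < l1, l1 < 1 / 10, 10 * d < l2 & l2 < 1 / 10].

Let k_gt0 : 0 < k.
Proof. by have [l1_gt0 l2_gt0 d_gt0] := pos; rewrite divr_gt0// mulr_gt0. Qed.

Let kE : k * l1 * l2 = d.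
Proof. by have [l1_gt0 l2_gt0 _] := pos; rewrite /k; field; rewrite !gt_eqF. Qed.

Let kl1 : k * l1 < 1 / 10.
Proof.
have [l1_gt0 l2_gt0 d_gt0] := pos. have [dl1 l1_lt dl2 l2_lt] := small.
rewrite -(ltr_pM2r l2_gt0) kE; lra.
Qed.

Let kl2 : k * l2 < 1 / 10.
Proof.
have [l1_gt0 l2_gt0 d_gt0] := pos. have [dl1 l1_lt dl2 l2_lt] := small.
rewrite -(ltr_pM2r l1_gt0) mulrAC kE; lra.
Qed.

Let tangent_affine (v t : R) :
  (v + l1) * (l2 - v) + (v - t) ^+ 2 = l1 * l2 + (l2 - l1 - 2 * t) * v + t ^+ 2.
Proof. ring. Qed.

(** The tangent slopes are extreme at [t = - l1] and [t = l2], where they equal [k (l1 + l2)] up to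
    sign; [10 d < l1] and [10 d < l2] make this less than 1/5. *)
Let slope_le t : - l1 <= t <= l2 -> `|k * (l2 - l1 - 2 * t)| <= 1 / 5.
Proof.
have [l1_gt0 l2_gt0 d_gt0] := pos. have [dl1 l1_lt dl2 l2_lt] := small.
move=> /andP[t1 t2]; have := k_gt0; have := kl1; have := kl2.
rewrite ler_norml => H1 H2 k0; apply/andP; split; nra.
Qed.

(** Over [|v| <= 2] a tangent drops at most 2/5 below its height at [v = 0], which is at least
    [2 + d], so it stays above 3/2. *)
Lemma parabolic_body_rect v w : `|v| <= 2 -> `|w| <= 5 / 2 -> w <= 3 / 2 ->
  parabolic_body (v, w).
Proof.
have [l1_gt0 l2_gt0 d_gt0] := pos. have [dl1 l1_lt dl2 l2_lt] := small.
move=> v2 w2 w3; split => //=; first by rewrite (le_trans v2)//; lra.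
move=> t tl; rewrite tangent_affine.
have : `|k * (l2 - l1 - 2 * t) * v| <= 1 / 5 * 2 by rewrite normrM ler_pM// slope_le.
rewrite ler_norml => /andP[H _].
have := mulr_ge0 (ltW k_gt0) (sqr_ge0 t).
have kll : k * (l1 * l2) = d by rewrite mulrA.
move: H; rewrite !mulrDr kll mulrA; lra.
Qed.

Lemma parabolic_body_under v w : `|v| <= 5 / 2 -> `|w| <= 5 / 2 ->
  w <= 2 + k * ((v + l1) * (l2 - v)) -> parabolic_body (v, w).
Proof.
have [l1_gt0 l2_gt0 d_gt0] := pos. have [dl1 l1_lt dl2 l2_lt] := small.
move=> v2 w2 wh; split => //= t _; apply: (le_trans wh).
by rewrite lerD2l ler_wpM2l ?(ltW k_gt0)// lerDl sqr_ge0.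
Qed.

Lemma parabolic_body_convex : convex_set parabolic_body.
Proof.
move=> a b lam; rewrite !inE => -[a1 a2 a3] [b1 b2 b3].
have [L0 L1] : 0 <= lam%:num /\ lam%:num <= 1 by split; [exact: ge0|exact: le1].
set L := lam%:num in L0 L1 *.
have convE : (conv lam a b : R * R) = (L * a.1 + (1 - L) * b.1, L * a.2 + (1 - L) * b.2).
  by [].
rewrite convE; split => /=.
- move: a1 b1; rewrite !ler_norml => /andP[? ?] /andP[? ?]; apply/andP; split; nra.
- move: a2 b2; rewrite !ler_norml => /andP[? ?] /andP[? ?]; apply/andP; split; nra.
move=> t tl; have := a3 t tl; have := b3 t tl; rewrite !tangent_affine => Hb Ha.
have L1' : 0 <= 1 - L by lra.
have := ler_wpM2l L0 Ha; have := ler_wpM2l L1' Hb; nra.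
Qed.

Lemma parabolic_body_compact : compact parabolic_body.
Proof.
apply: (@subclosed_compact _ _
  (`[- (5 / 2), 5 / 2]%classic `*` `[- (5 / 2), 5 / 2]%classic : set (R * R))).
- have cfst : continuous (fun y : R * R => y.1) by move=> y; exact: cvg_fst.
  have csnd : continuous (fun y : R * R => y.2) by move=> y; exact: cvg_snd.
  have cl (g : R * R -> R) c : continuous g -> closed [set y | g y <= c].
    by move=> cg; apply: (preimage_closed (f := g) (D := [set x | x <= c]));
      [move=> y _; exact: cg|exact: closed_le].
  have -> : parabolic_body = [set y | `|y.1| <= 5 / 2] `&` [set y | `|y.2| <= 5 / 2] `&`
      \bigcap_(t in [set t | - l1 <= t <= l2])
      [set y | y.2 - k * ((y.1 + l1) * (l2 - y.1) + (y.1 - t) ^+ 2) <= 2].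
    apply/seteqP; split => [y [y1 y2 y3]|y [[y1 y2] y3]]; split => //.
      by move=> t /= tl; rewrite lerBlDr y3.
    by move=> t tl; rewrite -lerBlDr; exact: y3.
  apply: closedI; first apply: closedI.
  + by apply: cl => y; apply: cvg_norm; exact: cfst.
  + by apply: cl => y; apply: cvg_norm; exact: csnd.
  + apply: closed_bigI => t _; apply: cl => y.
    apply: cvgB; first exact: csnd.
    apply: cvgM; first exact: cvg_cst.
    have c1 := cfst y.
    apply: cvgD; apply: cvgM; (do ?apply: cvgB); (do ?apply: cvgD); try exact: cvg_cst; exact: c1.
- by apply: compact_setX; exact: segment_compact.
- by move=> y [] /=; rewrite !ler_norml !in_itv.
Qed.

(** The uncountable family of constraints reduces to a single one: for given [v] the strictest
    tangent is at the point [clamp v] of [[- l1, l2]] nearest to [v], and [clamp] is measurable. *)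
Lemma parabolic_body_measurable :
  measurable (parabolic_body : set (measurableTypeR R * measurableTypeR R)).
Proof.
have [l1_gt0 l2_gt0 d_gt0] := pos. have [dl1 l1_lt dl2 l2_lt] := small.
pose clamp (v : R) := Num.max (- l1) (Num.min v l2).
have clampP v : - l1 <= clamp v <= l2.
  by rewrite /clamp le_max lexx ge_max ge_min lexx orbT andbT; lra.
have clamp_le v t : - l1 <= t <= l2 -> (v - clamp v) ^+ 2 <= (v - t) ^+ 2.
  move=> /andP[t1 t2]; rewrite /clamp; case: (leP v l2) => vl;
    [case: (leP (- l1) v) => lv|case: (leP (- l1) l2) => lv]; rewrite -subr_ge0.
  - by rewrite subrr expr0n subr0 sqr_ge0.
  - rewrite (_ : _ - _ = (t + l1) * (t - l1 - 2 * v)); last by ring.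
    by rewrite mulr_ge0//; lra.
  - rewrite (_ : _ - _ = (l2 - t) * (2 * v - t - l2)); last by ring.
    by rewrite mulr_ge0//; lra.
  - by lra.
have -> : parabolic_body = [set y | `|y.1| <= 5 / 2] `&` [set y | `|y.2| <= 5 / 2] `&`
    [set y | y.2 <= 2 + k * ((y.1 + l1) * (l2 - y.1) + (y.1 - clamp y.1) ^+ 2)].
  apply/seteqP; split => [y [y1 y2 y3]|y [[y1 y2] y3]]; split => //; first exact: y3.
  move=> t tl; apply: (le_trans y3).
  by rewrite lerD2l ler_wpM2l ?(ltW k_gt0)// lerD2l clamp_le.
pose T := (measurableTypeR R * measurableTypeR R)%type.
have mle (g h : T -> R) : measurable_fun setT g -> measurable_fun setT h ->
    measurable [set y | g y <= h y].
  move=> mg mh; have := measurable_fun_ler mg mh.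
  by move=> /(_ measurableT [set true]); rewrite setTI; apply.
have m1 : measurable_fun setT (fst : T -> R) by exact: measurable_fst.
have m2 : measurable_fun setT (snd : T -> R) by exact: measurable_snd.
have mc (c : R) : measurable_fun setT (cst c : T -> R) by exact: measurable_cst.
apply: measurableI; first apply: measurableI.
- by apply: mle => //; exact: measurableT_comp.
- by apply: mle => //; exact: measurableT_comp.
apply: mle => //; apply: measurable_funD => //; apply: measurable_funM => //.
apply: measurable_funD.
  by apply: measurable_funM; [exact: measurable_funD|exact: measurable_funB].
apply: measurable_funX; apply: measurable_funB => //.
by apply: measurable_maxr => //; exact: measurable_minr.
Qed.

Lemma parabolic_body_interior : parabolic_body° !=set0.
Proof.
exists (0, 0); apply: (filterS _ (nbhsx_ballx (0 : R * R) 1 ltr01)) => -[v w] [] /=.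
rewrite -!ball_normE /= !sub0r !normrN => v1 w1.
apply: parabolic_body_rect; [lra|lra|].
by rewrite (le_trans (ler_norm _))//; lra.
Qed.

Lemma parabolic_body_top : is_max [set t | parabolic_body (0, 2 + t)] d.
Proof.
have [l1_gt0 l2_gt0 d_gt0] := pos. have [dl1 l1_lt dl2 l2_lt] := small.
split => [|t [_ _ /(_ 0)]] /=.
  apply: parabolic_body_under; rewrite /= ?normr0; [lra| |].
    by rewrite ger0_norm; lra.
  by rewrite add0r subr0 mulrA kE.
have -> : - l1 <= 0 <= l2 by lra.
move=> /(_ isT); rewrite add0r subrr subr0 expr0n addr0 mulrA kE; lra.
Qed.

(** The tangent at [- l1] passes through [(- l1, 2)] with positive slope [k (l1 + l2)], so it cuts
    the chord at height 2 exactly there. *)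
Lemma parabolic_body_left : is_max [set t | parabolic_body (- t, 2)] l1.
Proof.
have [l1_gt0 l2_gt0 d_gt0] := pos. have [dl1 l1_lt dl2 l2_lt] := small.
split => [|t [_ _ /(_ (- l1))]] /=.
  apply: parabolic_body_under; rewrite ?normrN.
  - by rewrite gtr0_norm//; lra.
  - by rewrite gtr0_norm//; lra.
  - by rewrite addNr mul0r mulr0 addr0.
have -> : - l1 <= - l1 <= l2 by lra.
move=> /(_ isT); rewrite (_ : _ + _ = (l1 - t) * (l1 + l2)); last by ring.
rewrite lerDl pmulr_rge0// pmulr_lge0 ?addr_gt0// subr_ge0//.
Qed.

Lemma parabolic_body_right : is_max [set t | parabolic_body (t, 2)] l2.
Proof.
have [l1_gt0 l2_gt0 d_gt0] := pos. have [dl1 l1_lt dl2 l2_lt] := small.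
split => [|t [_ _ /(_ l2)]] /=.
  apply: parabolic_body_under.
  - by rewrite gtr0_norm//; lra.
  - by rewrite gtr0_norm//; lra.
  - by rewrite subrr mulr0 mulr0 addr0.
have -> : - l1 <= l2 <= l2 by lra.
move=> /(_ isT); rewrite (_ : _ + _ = (l2 - t) * (l1 + l2)); last by ring.
rewrite lerDl pmulr_rge0// pmulr_lge0 ?addr_gt0// subr_ge0//.
Qed.

Lemma parabolic_body_peval_le n (f : mpoly.mpoly 2 R) : poly_le R n f ->
  peval f (0, 2) ^+ 2 <=
  4 * (2 * n).+1%:R * (n%:R + 2 / Num.sqrt d) / Num.sqrt (Num.min (l1 * l2) d)
    * inner parabolic_body f f.
Proof.
have [l1_gt0 l2_gt0 d_gt0] := pos. have [dl1 l1_lt dl2 l2_lt] := small.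
move=> fn; set m := Num.min _ _.
have m0 : 0 < m by rewrite lt_min mulr_gt0.
have md : m <= d by rewrite ge_min lexx orbT.
have ml : m <= l1 * l2 by rewrite ge_min lexx.
(* This half-width gives [k A^2 = m / (l1 l2) <= 1], so the quadratic term of the parabola changes
   by at most 1 on [[- A, A]]. *)
pose A := Num.sqrt m / Num.sqrt d.
have sd0 : 0 < Num.sqrt d by rewrite sqrtr_gt0.
have A0 : 0 < A by rewrite divr_gt0// sqrtr_gt0.
have AA : A ^+ 2 = m / d by rewrite exprMn exprVn !sqr_sqrtr// ltW.
have A1 : A <= 1 by rewrite ler_pdivrMr// mul1r ler_sqrt// ltW.
have kA : k * A ^+ 2 <= 1.
  have -> : k * A ^+ 2 = m / (l1 * l2) by rewrite AA /k; field; rewrite !gt_eqF.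
  by rewrite ler_pdivrMr ?mulr_gt0// mul1r.
(* The parabola lowered by [d]; it passes through [(0, 2)] because [h 0 = d]. *)
pose Q : {poly R} := k *: (('X + l1%:P) * (l2%:P - 'X)) + (2 - d)%:P.
have QE v : Q.[v] = 2 + k * ((v + l1) * (l2 - v)) - d.
  by rewrite !(hornerD, hornerZ, hornerM, hornerN, hornerX, hornerC); ring.
have sQ : (size Q <= 3)%N.
  rewrite (leq_trans (size_polyD _ _))// geq_max (leq_trans (size_polyC_leq1 _))// andbT.
  rewrite (leq_trans (size_scale_leq _ _))// (leq_trans (size_polyMleq _ _))//.
  rewrite size_XaddC -opprB size_polyN size_XsubC//.
have [||F sF FE] := @peval_poly R f n 2 'X Q fn => //.
  by rewrite size_polyX.
have -> : peval f (0, 2) = F.[0].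
  by rewrite FE hornerX QE add0r subr0 mulrA kE addrK.
apply: (le_trans (horner_mid_le F (2 * n) A sF A0)).
pose top v := 2 + k * ((v + l1) * (l2 - v)).
(* Each segment has centre [top v - 1] and half-length 1, so its point at depth [d] is [Q.[v] = top
   v - d]. *)
have := Rintegral_strip_le parabolic_body (5 / 2) parabolic_body_measurable _ F f (- A) A
  (fun v => top v - 1 - 1) (fun v => top v - 1 + 1) (4 * (n%:R + 2 / Num.sqrt d) / Num.sqrt d).
set I := inner _ _ _; set J := \int[_]_(_ in _) _ => H.
suff : J <= 4 * (n%:R + 2 / Num.sqrt d) / Num.sqrt d * I.
  move=> /(ler_wpM2l (_ : 0 <= (2 * n).+1%:R / A)) => /(_ _)/le_trans; apply.
    by rewrite divr_ge0// ltW.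
  rewrite le_eqVlt; apply/orP; left; apply/eqP; rewrite /A.
  by field; rewrite !gt_eqF// sqrtr_gt0.
apply: H.
- by move=> y [].
- by rewrite divr_ge0 ?sqrtr_ge0// mulr_ge0// addr_ge0// divr_ge0 ?sqrtr_ge0.
(* For [|v| <= A <= 1] the linear term of [top v] is at most 1/5 in size and the quadratic one lies
   in [[-1, 0]], so the segment stays within height 5/2 in absolute value. *)
- move=> v w vA wt.
  have vA2 : v ^+ 2 <= A ^+ 2 by case/andP: vA => ? ?; nra.
  have v1 : `|v| <= 1 by rewrite ler_norml; lra.
  have kv2 : k * v ^+ 2 <= 1 by rewrite (le_trans _ kA)// ler_wpM2l// ltW.
  have topE : top v = 2 + d + k * (l2 - l1) * v - k * v ^+ 2.
    by rewrite /top -[d in RHS]kE; ring.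
  have s1 : `|k * (l2 - l1) * v| <= 1 / 5.
    have := @slope_le 0; rewrite mulr0 subr0 => s0.
    rewrite normrM -[leRHS]mulr1 ler_pM// s0//; lra.
  have kv0 : 0 <= k * v ^+ 2 by rewrite mulr_ge0 ?sqr_ge0// ltW.
  move: s1; rewrite ler_norml => s1.
  apply: parabolic_body_under.
  + lra.
  + rewrite ler_norml; lra.
  + rewrite -/(top v); lra.
move=> v vA.
have [||r sr rE] := @peval_poly R f n 1 v%:P 'X fn.
- by rewrite (leq_trans (size_polyC_leq1 _)).
- by rewrite size_polyX.
rewrite mul1n in sr; have := @horner_endpoint_le R r n (top v - 1) d sr d_gt0 _.
rewrite FE rE hornerX QE hornerC hornerX subrK => H.
apply: le_trans (H _) _; first lra.
rewrite le_eqVlt; apply/orP; left; apply/eqP; congr (_ * _).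
by apply: eq_Rintegral => w _; rewrite rE hornerC hornerX.
Qed.

End ParabolicBody.

(** * The choice of body, point and constant *)

Theorem theorem1p5 (R : realType) :
  exists c : R -> R, (forall sigma : R, 0 < sigma -> 0 < c sigma) /\
  forall l1 l2 delta : R,
    0 < l1 -> 0 < l2 -> 0 < delta ->
    10 * delta < l1 -> l1 < 1 / 10 ->
    10 * delta < l2 -> l2 < 1 / 10 ->
  exists (D : set (R * R)) (x v : R * R),
    let u : R * R := (enorm x)^-1 *: x in
    [/\ [/\ convex_body D, D x, x != 0,
            unit_disk R `<=` D & D `<=` (fun y : R * R => 4 *: y) @` unit_disk R],
        enorm v = 1 /\ dot u v = 0,
        is_max [set t | D (x + t *: u)] delta,
        is_max [set t | D (x - t *: v)] l1 /\
        is_max [set t | D (x + t *: v)] l2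
      & forall (sigma : R) (n : nat),
          0 < sigma -> (0 < n)%N -> sigma * n%:R ^- 2 < delta ->
          c sigma * n%:R ^- 2 * Num.sqrt (Num.min (l1 * l2) delta)
            <= christoffel n D x].
Proof.
(* The 12 is the factor 4 of the body estimate times 3 from [2 n + 1 <= 3 n]; the term [2 / sqrt s]
   comes from [1 / sqrt d <= n / sqrt s]. *)
exists (fun s => (12 * (1 + 2 / Num.sqrt s))^-1); split.
  by move=> s s0; rewrite invr_gt0 mulr_gt0// addr_gt0// divr_gt0// sqrtr_gt0.
move=> l1 l2 d l1_gt0 l2_gt0 d_gt0 dl1 l1_lt dl2 l2_lt.
have pos : [/\ 0 < l1, 0 < l2 & 0 < d] by [].
have small : [/\ 10 * d < l1, l1 < 1 / 10, 10 * d < l2 & l2 < 1 / 10] by [].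
have x2 : enorm ((0, 2) : R * R) = 2.
  by rewrite /enorm /dot /= mul0r add0r -expr2 sqrtr_sqr ger0_norm.
exists (parabolic_body l1 l2 d), (0, 2), (1, 0) => u.
have -> : u = (0, 1).
  by rewrite /u x2; congr pair => /=; [exact: mulr0|exact: mulVf].
split.
- split.
  + split; [exact: parabolic_body_convex|exact: parabolic_body_compact|].
    exact: parabolic_body_interior.
  + apply: parabolic_body_under => //; rewrite ?normr0 ?ger0_norm//; try lra.
    by rewrite add0r subr0 lerDl mulr_ge0 ?divr_ge0 ?mulr_ge0// ltW.
  + by apply/eqP => -[/eqP]; rewrite pnatr_eq0.
  + move=> [v w]; rewrite /unit_disk /enorm /dot /= => H.
    have : v * v + w * w <= 1.
      rewrite -[leLHS]sqr_sqrtr ?expr_le1 ?sqrtr_ge0// addr_ge0// -expr2 sqr_ge0//.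
    move=> vw; apply: parabolic_body_rect => //.
    * by rewrite ler_norml; nra.
    * by rewrite ler_norml; nra.
    * by nra.
  (* The box of half-side 5/2 has squared circumradius 25/2, which is below 16. *)
  + move=> [v w] [/= v1 w1 _]; exists (4^-1 * v, 4^-1 * w); last first.
      by congr pair; rewrite /= [LHS]mulrA divff ?mul1r.
    rewrite /unit_disk /enorm /dot /= -[leRHS]sqrtr1 ler_sqrt//.
    by move: v1 w1; rewrite !ler_norml => /andP[? ?] /andP[? ?]; nra.
- split; first by rewrite /enorm /dot /= mul0r addr0 mulr1 sqrtr1.
  by rewrite /dot /= mul0r mulr0 addr0.
- have := parabolic_body_top l1 l2 d pos small.
  congr is_max; apply/funext => t; congr parabolic_body.
  by rewrite -[RHS]/(0 + t * 0, 2 + t * 1) mulr0 mulr1 addr0.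
- split.
    have := parabolic_body_left l1 l2 d pos small.
    congr is_max; apply/funext => t; congr parabolic_body.
    by rewrite -[RHS]/(0 - t * 1, 2 - t * 0) mulr0 mulr1 subr0 sub0r.
  have := parabolic_body_right l1 l2 d pos small.
  congr is_max; apply/funext => t; congr parabolic_body.
  by rewrite -[RHS]/(0 + t * 1, 2 + t * 0) mulr0 mulr1 addr0 add0r.
move=> s n s0 n0 snd; set m := Num.min _ _.
have m0 : 0 < m by rewrite lt_min mulr_gt0.
have n0' : 0 < n%:R :> R by rewrite ltr0n.
have ss0 : 0 < Num.sqrt s by rewrite sqrtr_gt0.
have sm0 : 0 < Num.sqrt m by rewrite sqrtr_gt0.
have sd0 : 0 < Num.sqrt d by rewrite sqrtr_gt0.
have sd : 2 / Num.sqrt d <= n%:R * (2 / Num.sqrt s).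
  rewrite mulrCA ler_wpM2l// -(ler_pM2r sd0) mulVf ?gt_eqF//.
  rewrite mulrAC -(ler_pM2r ss0) mulfVK ?gt_eqF// mul1r.
  rewrite -[n%:R]ger0_norm ?ler0n// -sqrtr_sqr -sqrtrM ?sqr_ge0//.
  rewrite ler_sqrt; last by rewrite mulr_ge0 ?sqr_ge0// ltW.
  by rewrite mulrC -ler_pdivrMr ?exprn_gt0// ltW.
pose K := 12 * (1 + 2 / Num.sqrt s) * n%:R ^+ 2 / Num.sqrt m.
have K0 : 0 < K.
  by rewrite divr_gt0// mulr_gt0 ?exprn_gt0// mulr_gt0// addr_gt0// divr_gt0.
have -> : (12 * (1 + 2 / Num.sqrt s))^-1 * n%:R ^- 2 * Num.sqrt m = K^-1.
  by rewrite /K !invfM invrK.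
have mD := parabolic_body_measurable l1 l2 d pos small.
have DB y : parabolic_body l1 l2 d y -> `|y.1| <= 5 / 2 /\ `|y.2| <= 5 / 2.
  by case.
apply: (christoffel_ge _ _ mD DB _ _ _ K0) => f fn.
  apply: (inner_eq0 _ _ mD DB _ _ _ fn) => v w v1 w1.
  by apply: parabolic_body_rect => //; rewrite ?ler_norml; lra.
have := parabolic_body_peval_le l1 l2 d pos small n f fn.
move: (inner_ge0 (parabolic_body l1 l2 d) f); set I := inner _ f f => I0 H.
apply: (le_trans H); apply: ler_wpM2r => //.
apply: ler_wpM2r; first by rewrite invr_ge0 ltW.
have n1 : (2 * n).+1%:R <= 3 * n%:R :> R.
  by rewrite -[3]/(3%:R) -natrM ler_nat mulSn -[X in (X < _)%N]add0n ltn_add2r.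
apply: (@le_trans _ _ (4 * (3 * n%:R) * (n%:R + n%:R * (2 / Num.sqrt s)))).
  apply: ler_pM.
  - by rewrite mulr_ge0.
  - by rewrite addr_ge0// divr_ge0// ltW.
  - by rewrite ler_wpM2l.
  - by rewrite lerD2l.
rewrite le_eqVlt; apply/orP; left; apply/eqP; ring.
Qed.
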